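(* For integers $r,n\ge 0$ let $h_r(n)$ denote the number of permutations in $S_n$ that avoid the generalized pattern $21\text{-}3$ and contain exactly $r$ occurrences of the generalized pattern $31\text{-}2$, and let $H_r(x)=\sum_{n\ge 0} h_r(n)x^n$. Then for every integer $r\ge 0$, $$H_r(x)=\frac{1-x}{1-2x}\,\delta_{r,0}+\frac{x^2}{1-2x}\sum_{d=1}^{r}\frac{H_{r-d}(x)-\sum_{j=0}^{d-1}h_{r-d}(j)x^j}{(1-x)^d}.$$
   Context: $S_n$ is the set of permutations $\pi=\pi_1\pi_2\cdots\pi_n$ of $\{1,\dots,n\}$; $S_0$ consists of the empty permutation only. An occurrence of a generalized pattern $ab\text{-}c$ (with $abc$ a permutation of $\{1,2,3\}$) in $\pi$ is a pair $(i,j)$ with $i+1<j\le n$ such that $(\pi_i,\pi_{i+1},\pi_j)$ is order-isomorphic to $(a,b,c)$ (so the first two letters are adjacent in $\pi$). $\pi$ avoids the pattern if it has no occurrence of it. $\delta_{r,0}$ is the Kronecker delta. The identity is one of formal power series. *)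

(* Defs.v *)
From HB Require Import structures.
From mathcomp Require Import all_boot all_order all_algebra all_fingroup.
From mathcomp Require Import boolp.

Set Implicit Arguments.
Unset Strict Implicit.
Unset Printing Implicit Defensive.

Import GRing.Theory.

Record fps (R : Type) := Fps { coefs :> nat -> R }.

HB.instance Definition _ (R : Type) := gen_eqMixin (fps R).
HB.instance Definition _ (R : Type) := gen_choiceMixin (fps R).

Section FormalPowerSeries.
Local Open Scope ring_scope.
Variable R : comNzRingType.
Implicit Types f g k : fps R.

Lemma fpsP f g : (forall n, f n = g n) <-> f = g.
Proof.
split=> [|-> //]; case: f; case: g => u v /= uv.
by congr Fps; apply/funext.
Qed.

Definition fps_zero : fps R := Fps (fun=> 0).
Definition fps_opp f : fps R := Fps (fun n => - f n).
Definition fps_add f g : fps R := Fps (fun n => f n + g n).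
Definition fps_one : fps R := Fps (fun n => (n == 0%N)%:R).
Definition fps_mul f g : fps R :=
  Fps (fun n => \sum_(i < n.+1) f i * g (n - i)%N).

Fact fps_addA : associative fps_add.
Proof. by move=> f g k; apply/fpsP => n /=; rewrite addrA. Qed.
Fact fps_addC : commutative fps_add.
Proof. by move=> f g; apply/fpsP => n /=; rewrite addrC. Qed.
Fact fps_add0 : left_id fps_zero fps_add.
Proof. by move=> f; apply/fpsP => n /=; rewrite add0r. Qed.
Fact fps_addN : left_inverse fps_zero fps_opp fps_add.
Proof. by move=> f; apply/fpsP => n /=; rewrite addNr. Qed.

HB.instance Definition _ :=
  GRing.isZmodule.Build (fps R) fps_addA fps_addC fps_add0 fps_addN.

Definition fps_trunc m f : {poly R} := \poly_(i < m) f i.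

Lemma coef_fps_trunc m f i : (i < m)%N -> (fps_trunc m f)`_i = f i.
Proof. by move=> im; rewrite coef_poly im. Qed.

Lemma fps_mul_trunc m f g n : (n < m)%N ->
  fps_mul f g n = (fps_trunc m f * fps_trunc m g)`_n.
Proof.
move=> nm; rewrite coefM; apply: eq_bigr => i _.
rewrite !coef_fps_trunc //; first exact: leq_ltn_trans (leq_subr _ _) nm.
by apply: leq_trans nm; rewrite ltn_ord.
Qed.

Fact fps_mulA : associative fps_mul.
Proof.
move=> f g k; apply/fpsP => n.
transitivity (fps_trunc n.+1 f * (fps_trunc n.+1 g * fps_trunc n.+1 k))`_n.
  rewrite coefM; apply: eq_bigr => i _; rewrite coef_fps_trunc //.
  by rewrite (@fps_mul_trunc n.+1) // ltnS leq_subr.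
rewrite mulrA coefM; apply: eq_bigr => i _.
rewrite (@fps_mul_trunc n.+1) // coef_fps_trunc //.
by rewrite ltnS leq_subr.
Qed.

Fact fps_mulC : commutative fps_mul.
Proof.
by move=> f g; apply/fpsP => n; rewrite !(@fps_mul_trunc n.+1) // mulrC.
Qed.

Fact fps_mul1 : left_id fps_one fps_mul.
Proof.
move=> f; apply/fpsP => n /=; rewrite big_ord_recl /= mul1r subn0.
by rewrite big1 ?addr0 // => i _; rewrite mul0r.
Qed.

Fact fps_mulDl : left_distributive fps_mul fps_add.
Proof.
move=> f g k; apply/fpsP => n /=; rewrite -big_split.
by apply: eq_bigr => i _; rewrite mulrDl.
Qed.

Fact fps_one_neq0 : fps_one != 0.
Proof.
apply/negP => /eqP /fpsP /(_ 0%N) /= /eqP.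
by rewrite (oner_eq0 R).
Qed.

HB.instance Definition _ := GRing.Zmodule_isComNzRing.Build (fps R)
  fps_mulA fps_mulC fps_mul1 fps_mulDl fps_one_neq0.

(* [f^-1] is the multiplicative inverse of [f] when there is one and, by the  *)
(* MathComp convention, [f] itself otherwise.                                 *)
Definition fps_unit : {pred fps R} := [pred f | `[< exists g, g * f = 1 >]].

Definition fps_inv f : fps R :=
  if pselect (exists g, g * f = 1) is left fV then projT1 (cid fV) else f.

Fact fps_mulV : {in fps_unit, left_inverse 1 fps_inv *%R}.
Proof.
by move=> f /asboolP fV; rewrite /fps_inv; case: pselect => // ?; case: cid.
Qed.

Fact fps_unitPl f g : g * f = 1 -> fps_unit f.
Proof. by move=> gf; apply/asboolP; exists g. Qed.

Fact fps_inv_out : {in [predC fps_unit], fps_inv =1 id}.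
Proof. by move=> f /asboolPn fV; rewrite /fps_inv; case: pselect. Qed.

HB.instance Definition _ := GRing.ComNzRing_hasMulInverse.Build (fps R)
  fps_mulV fps_unitPl fps_inv_out.

Definition fpsX : fps R := Fps (fun n => (n == 1%N)%:R).

Lemma fpsE0 n : (0 : fps R) n = 0. Proof. by []. Qed.
Lemma fpsE1 n : (1 : fps R) n = (n == 0%N)%:R. Proof. by []. Qed.
Lemma fpsED f g n : (f + g) n = f n + g n. Proof. by []. Qed.
Lemma fpsEN f n : (- f) n = - f n. Proof. by []. Qed.
Lemma fpsEM f g n : (f * g) n = \sum_(i < n.+1) f i * g (n - i)%N.
Proof. by []. Qed.

Lemma fpsEXM f n : (fpsX * f) n = if n is m.+1 then f m else 0.
Proof.
rewrite fpsEM; case: n => [|n]; first by rewrite big_ord1 mul0r.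
rewrite !big_ord_recl /= mul0r add0r mul1r subSS subn0.
by rewrite big1 ?addr0 // => i _; rewrite mul0r.
Qed.

Lemma fpsEXn j n : (fpsX ^+ j) n = (n == j)%:R.
Proof.
elim: j n => [|j IH] n; first by rewrite expr0.
by rewrite exprS fpsEXM; case: n.
Qed.

Lemma fpsEMn f m n : (f *+ m) n = f n *+ m.
Proof. by elim: m => [|m IH]; rewrite ?mulr0n // !mulrS fpsED IH. Qed.

Lemma fps_1BcX_unit (c : nat) : 1 - c%:R * fpsX \is a GRing.unit.
Proof.
apply: (@fps_unitPl _ (Fps (fun n => c%:R ^+ n))).
rewrite mulrC mulrBl mul1r -mulrA mulr_natl; apply/fpsP => n.
rewrite fpsED fpsEN fpsEMn fpsEXM fpsE1; case: n => [|n] /=.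
  by rewrite expr0 mul0rn subr0.
by rewrite exprS mulr_natl subrr.
Qed.

End FormalPowerSeries.

Arguments fpsX {R}.

Section GeneralizedPatterns.

Definition order_iso (s t : seq nat) : bool :=
  (size s == size t) &&
  all2rel (fun i j => (nth 0 s i < nth 0 s j) == (nth 0 t i < nth 0 t j))
          (iota 0 (size s)).

(* The word pi_1 ... pi_n, with letters in {1, ..., n}; positions in the      *)
(* sequence start at 0.                                                       *)
Definition word n (pi : 'S_n) : seq nat := [seq (val (pi i)).+1 | i : 'I_n].

Definition letter n (pi : 'S_n) (i : nat) : nat := nth 0 (word pi) i.

(* Occurrences of ab-c, where the pattern is given as [:: a; b; c].           *)
Definition occurrences (p : seq nat) n (pi : 'S_n) : {set 'I_n * 'I_n} :=
  [set ij : 'I_n * 'I_n | (ij.1.+1 < ij.2) &&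
     order_iso [:: letter pi ij.1; letter pi ij.1.+1; letter pi ij.2] p].

Definition avoids (p : seq nat) n (pi : 'S_n) : bool :=
  occurrences p pi == set0.

Definition h (r n : nat) : nat :=
  #|[set pi : 'S_n | avoids [:: 2; 1; 3] pi &
                     #|occurrences [:: 3; 1; 2] pi| == r]|.

Definition H (r : nat) : fps rat := Fps (fun n => ((h r n)%:R)%R).

End GeneralizedPatterns.

(* Main.v *)
Require Import Defs.
From mathcomp Require Import all_boot all_order all_algebra all_fingroup.
From mathcomp Require Import zify.

(* Prepend a letter k to a permutation s of size n > 0 with first letter j.
   If k <= j (so that j becomes j + 1), no occurrence of either pattern is
   created; if k > j, avoiding 21-3 forces k to be the new maximum, and then
   n - j occurrences of 31-2 appear. Hence, writing e(d, n) for the number of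
   admissible permutations of size n + 1 with first letter n + 1 - d and r
   occurrences of 31-2,
     e(d + 1, n + 1) = e(d, n + 1) + e(d, n)            for 1 <= d <= n,
     e(0, n + 1)     = sum_(d <= n) e_(r - d)(d, n),    e(n, n) = h_r(n).
   Expanding along Pascal's rule, h_r(n + 2) - 2 h_r(n + 1) is the sum over d
   of P(d, n) = sum_(k >= d) 'C(n, k) e_(r - d)(d, k). The Pascal recurrence
   determines e(d, k) for k >= d from the diagonal e(m, m) = h(m), which turns
   P(d, n) into sum_(m = d .. n) 'C(n - m + d - 1, d - 1) h_(r - d)(m): the
   coefficient of x^n in the d-th term of the sum. *)

Set Implicit Arguments.
Unset Strict Implicit.
Unset Printing Implicit Defensive.

(** * Occurrences of the two patterns as inequalities between letters *)

Lemma order_iso213 a b c : order_iso [:: a; b; c] [:: 2; 1; 3] = (b < a < c).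
Proof.
rewrite /order_iso /allrel /= !ltnn !eqxx /= !eqbF_neg !andbT.
by apply/idP/idP; lia.
Qed.

Lemma order_iso312 a b c : order_iso [:: a; b; c] [:: 3; 1; 2] = (b < c < a).
Proof.
rewrite /order_iso /allrel /= !ltnn !eqxx /= !eqbF_neg !andbT.
by apply/idP/idP; lia.
Qed.

Lemma ltn_bump2 h i j : (bump h i < bump h j) = (i < j).
Proof. by rewrite !ltnNge leq_bump2. Qed.

Lemma letterE n (pi : 'S_n) (i : 'I_n) : letter pi i = (pi i).+1.
Proof.
rewrite /letter /word (nth_map i) ?size_enum_ord //.
by rewrite nth_ord_enum.
Qed.

(** Positions are naturals, so that prepending a letter shifts them by a plain successor. *)
Definition occurs p n (pi : 'S_n) i j : bool :=
  (i.+1 < j) && order_iso [:: letter pi i; letter pi i.+1; letter pi j] p.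

Lemma card_occurrences p n (pi : 'S_n) :
  #|occurrences p pi| = \sum_(i < n) \sum_(j < n) occurs p pi i j.
Proof.
rewrite -sum1_card big_mkcond pair_bigA /=; apply: eq_bigr => ij _.
by rewrite inE /occurs; case: ifP.
Qed.

(** * Prepending a letter *)

Section Prepend.
Variables (n : nat) (k : 'I_n.+1) (s : 'S_n).
Local Notation pi := (lift_perm ord0 k s).

Lemma letter_prepend0 : letter pi 0 = k.+1.
Proof. by rewrite (letterE _ ord0) lift_perm_id. Qed.

Lemma letter_prepend (i : 'I_n) : letter pi i.+1 = bump k.+1 (letter s i).
Proof.
by rewrite -(lift0 i) !letterE lift_perm_lift /= bumpS.
Qed.

Lemma occurs_prepend p (i j : 'I_n) : occurs p pi i.+1 j.+1 = occurs p s i j.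
Proof.
rewrite /occurs ltnS; case: (ltnP i.+1 j) => //= ij.
have i1n : i.+1 < n by apply: leq_trans (ltn_ord j); apply: ltnW.
rewrite !letter_prepend (letter_prepend (Ordinal i1n)) /order_iso /allrel /=.
by rewrite !ltn_bump2.
Qed.

(** The third letter of an occurrence lies to the right of the other two, so the new position 0 can
    only carry the first. *)
Lemma card_occurrences_prepend p :
  #|occurrences p pi| =
  \sum_(j < n) occurs p pi 0 j.+1 + #|occurrences p s|.
Proof.
rewrite !card_occurrences big_ord_recl big_ord_recl /= add0n; congr (_ + _).
apply: eq_bigr => i _; rewrite big_ord_recl add0n.
by apply: eq_bigr => j _; rewrite !lift0 occurs_prepend.
Qed.

End Prepend.

Lemma lift_perm0_surj n (pi : 'S_n.+1) :
  exists s : 'S_n, pi = lift_perm ord0 (pi ord0) s.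
Proof.
have neq (i : 'I_n) : pi ord0 != pi (lift ord0 i).
  by rewrite (inj_eq perm_inj) neq_lift.
(* Standardization of the tail; by [neq] the [odflt] default is never reached. *)
have f_inj : injective (fun i => odflt i (unlift (pi ord0) (pi (lift ord0 i)))).
  move=> i j /=; case: (unlift_some (neq i)) => i' ei ->.
  case: (unlift_some (neq j)) => j' ej -> /= ij.
  by apply: (@lift_inj _ ord0); apply: (@perm_inj _ pi); rewrite ei ej ij.
exists (perm f_inj); apply/permP => i.
case: (unliftP ord0 i) => [j|] ->; last by rewrite lift_perm_id.
by rewrite lift_perm_lift permE; case: (unlift_some (neq j)) => j' ej ->.
Qed.

Lemma lift_perm_inj n (i j : 'I_n.+1) : injective (lift_perm i j).
Proof.
move=> s t /permP st; apply/permP => k; apply: (@lift_inj _ j).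
by rewrite -!(lift_perm_lift i) st.
Qed.

Lemma card_perm_prepend n (k : 'I_n.+1) (P : pred 'S_n.+1) :
  #|[set pi | P pi & pi ord0 == k]| = #|[set s | P (lift_perm ord0 k s)]|.
Proof.
rewrite -(card_imset _ (@lift_perm_inj _ ord0 k)); apply: eq_card => pi.
rewrite inE; apply/andP/imsetP => [[Ppi /eqP pik]|[s]].
  have [s pis] := lift_perm0_surj pi; exists s; last by rewrite pis pik.
  by rewrite inE -pik -pis.
by rewrite inE => Ps ->; rewrite lift_perm_id.
Qed.

(** * Which letters can be prepended, and at what cost in 31-2 *)

Definition good r n (pi : 'S_n) : bool :=
  avoids [:: 2; 1; 3] pi && (#|occurrences [:: 3; 1; 2] pi| == r).

Lemma avoidsE p n (pi : 'S_n) : avoids p pi = (#|occurrences p pi| == 0).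
Proof. by rewrite cards_eq0. Qed.

Lemma sum_ltn_ltn a b n : \sum_(j < n) (a < j < b) = (minn b n).-1 - a.
Proof.
elim: n => [|n IHn]; first by rewrite big_ord0; lia.
by rewrite big_ord_recr /= IHn; case: (ltnP a n); case: (ltnP n b); lia.
Qed.

Section PrependGood.
Variables (n : nat) (k : 'I_n.+2) (s : 'S_n.+1).
Local Notation pi := (lift_perm ord0 k s).

Lemma letter_prepend1 : letter pi 1 = bump k.+1 (s ord0).+1.
Proof. by rewrite (letter_prepend k s ord0) letterE. Qed.

Lemma occurs213_prepend (j : 'I_n.+1) :
  occurs [:: 2; 1; 3] pi 0 j.+1 = (s ord0 < k <= s j).
Proof.
rewrite /occurs letter_prepend0 letter_prepend letter_prepend1 order_iso213.
(* If [j] is [ord0], the third letter would be the second one, and both sides are false. *)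
rewrite letterE /bump; case: (unliftP ord0 j) => [i|] ->; rewrite ?lift0 /=.
  move: (s ord0 : nat) (s _ : nat) (k : nat) => a b c.
  by case: (leqP c.+1 a.+1) => ?; case: (leqP c.+1 b.+1) => ?; apply/idP/idP; lia.
move: (s ord0 : nat) (k : nat) => a c.
by case: (leqP c.+1 a.+1) => ?; apply/idP/idP; lia.
Qed.

Lemma occurs312_prepend (j : 'I_n.+1) :
  occurs [:: 3; 1; 2] pi 0 j.+1 = (s ord0 < s j < k).
Proof.
rewrite /occurs letter_prepend0 letter_prepend letter_prepend1 order_iso312.
rewrite letterE /bump; case: (unliftP ord0 j) => [i|] ->; rewrite ?lift0 /=.
  move: (s ord0 : nat) (s _ : nat) (k : nat) => a b c.
  by case: (leqP c.+1 a.+1) => ?; case: (leqP c.+1 b.+1) => ?; apply/idP/idP; lia.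
move: (s ord0 : nat) (k : nat) => a c.
by case: (leqP c.+1 a.+1) => ?; apply/idP/idP; lia.
Qed.

Lemma avoids213_prepend :
  avoids [:: 2; 1; 3] pi =
  ((k <= s ord0) || (k == ord_max)) && avoids [:: 2; 1; 3] s.
Proof.
rewrite !avoidsE card_occurrences_prepend addn_eq0; congr (_ && _).
rewrite sum_nat_eq0; apply/forallP/idP => [nocc|].
  case: leqP => //= sk; apply/eqP/val_inj => /=.
  have := ltn_ord k; rewrite ltnS leq_eqVlt => /predU1P[//|kn].
  (* The old value [k], raised by the insertion, completes a 21-3 with the initial descent. *)
  pose j : 'I_n.+1 := (s^-1)%g (Ordinal kn).
  by have := nocc j; rewrite (occurs213_prepend j) permKV /= sk leqnn.
case/orP=> [ks|/eqP km] j; rewrite occurs213_prepend; first by rewrite ltnNge ks.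
by rewrite km /= andbC leqNgt ltn_ord.
Qed.

(** Each value strictly between [s ord0] and [k] lies to the right of the initial descent and gives
    one occurrence. Truncated subtraction yields 0 when there is no descent. *)
Lemma card_occurrences312_prepend :
  #|occurrences [:: 3; 1; 2] pi| =
  k.-1 - s ord0 + #|occurrences [:: 3; 1; 2] s|.
Proof.
rewrite card_occurrences_prepend; congr (_ + _).
transitivity (\sum_(j < n.+1) (s ord0 < j < k)).
  rewrite [RHS](reindex_inj (@perm_inj _ s)).
  by apply: eq_bigr => j _; rewrite occurs312_prepend.
by rewrite sum_ltn_ltn (minn_idPl _) // -ltnS.
Qed.

End PrependGood.

Lemma good_prepend_lt r n (k : 'I_n.+2) (s : 'S_n.+1) : k != ord_max ->
  good r (lift_perm ord0 k s) = (k <= s ord0) && good r s.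
Proof.
move=> kmax; rewrite /good avoids213_prepend (negPf kmax) orbF -andbA.
case: leqP => //= ks; rewrite card_occurrences312_prepend.
by rewrite (_ : k.-1 - s ord0 = 0) //; lia.
Qed.

Lemma good_prepend_max r n (s : 'S_n.+1) :
  good r (lift_perm ord0 ord_max s) =
  (n - s ord0 <= r) && good (r - (n - s ord0)) s.
Proof.
rewrite /good avoids213_prepend eqxx orbT card_occurrences312_prepend /=.
case: avoids; rewrite ?andbF //=.
move: (_ - _) #|_| => a b; by apply/idP/idP; lia.
Qed.

(* The size is [n.+1], and [d] counts the letters above the first one: [d = 0]
   when the first letter is the largest. *)
Definition starting r d n : nat :=
  #|[set pi : 'S_n.+1 | good r pi & pi ord0 + d == n]|.

(** * Recurrences for the counts by first letter *)

Lemma good_small r n (pi : 'S_n) : n <= 1 -> good r pi = (r == 0).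
Proof.
move=> n1; have occ0 p : #|occurrences p pi| = 0.
  rewrite card_occurrences big1 // => i _; rewrite big1 // => j _.
  by have := ltn_ord j; rewrite /occurs; case: ltnP => // ij; lia.
by rewrite /good avoidsE !occ0 eqxx eq_sym.
Qed.

Lemma h_small r n : n <= 1 -> h r n = (r == 0).
Proof.
move=> n1; rewrite /h (eq_card (B := [pred pi : 'S_n | r == 0])).
  case: (r == 0); last by rewrite eq_card0.
  by rewrite (eq_card (B := {: 'S_n})) // card_Sn; case: n n1 => [|[]].
by move=> pi; rewrite inE -(good_small r pi n1).
Qed.

Lemma card_first_gt n d (P : pred 'S_n.+1) : d <= n.+1 ->
  #|[set pi | P pi & n - pi ord0 < d]| =
  \sum_(i < d) #|[set pi | P pi & pi ord0 + i == n]|.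
Proof.
move=> dn; under [RHS]eq_bigr do rewrite -sum1_card big_mkcond.
rewrite -sum1_card big_mkcond exchange_big /=; apply: eq_bigr => pi _.
rewrite inE; under [RHS]eq_bigr do rewrite inE.
have := leq_ord (pi ord0); move: (pi ord0 : nat) => a an.
case: (P pi) => /=; last by rewrite big1.
under eq_bigr => i _ do rewrite -[if _ then _ else _]/(nat_of_bool _).
case: ltnP => [ad|da].
  rewrite (bigD1 (Ordinal ad)) //= subnKC // eqxx big1 // => i.
  rewrite -val_eqE /=; case: eqP => //; lia.
by rewrite big1 // => i _; have := ltn_ord i; case: eqP => //; lia.
Qed.

Lemma h_starting r n : h r n.+1 = \sum_(i < n.+1) starting r i n.
Proof.
rewrite -card_first_gt //; apply: eq_card => pi; rewrite !inE.
by rewrite ltnS leq_subr andbT.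
Qed.

Lemma card_first n d (P : pred 'S_n.+1) (dn : d <= n) :
  #|[set pi | P pi & pi ord0 + d == n]| =
  #|[set pi | P pi & pi ord0 == rev_ord (Ordinal (dn : d < n.+1))]|.
Proof.
apply: eq_card => pi; rewrite !inE -val_eqE /= subSS.
by congr (_ && _); apply/eqP/eqP; lia.
Qed.

(** As [d > 0], the new letter is not the maximum, so it must not exceed [s ord0]: fewer than [d]
    letters of [s] lie above its first one. *)
Lemma starting_pos r d n : 0 < d <= n.+1 ->
  starting r d n.+1 = \sum_(i < d) starting r i n.
Proof.
case/andP=> d0 dn; rewrite /starting (card_first _ dn) card_perm_prepend.
rewrite -card_first_gt //; apply: eq_card => s; rewrite !inE.
rewrite good_prepend_lt -?val_eqE /= ?subSS; last by apply/eqP; lia.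
by rewrite andbC; congr (_ && _); have := leq_ord (s ord0); lia.
Qed.

(** Prepending the maximum to a permutation with [i] letters above its first creates [i] occurrences
    of 31-2. *)
Lemma starting0 r n :
  starting r 0 n.+1 = \sum_(i < n.+1 | i <= r) starting (r - i) i n.
Proof.
rewrite /starting (card_first _ (leq0n _)) card_perm_prepend.
have -> : rev_ord (Ordinal (leq0n n.+1 : 0 < n.+2)) = ord_max.
  by apply/val_inj; rewrite /= subSS subn0.
under [RHS]eq_bigr do rewrite -sum1_card big_mkcond.
rewrite -sum1_card big_mkcond exchange_big /=; apply: eq_bigr => s _.
rewrite inE good_prepend_max; under [RHS]eq_bigr do rewrite inE.
rewrite big_mkcond (bigD1 (rev_ord (s ord0))) //= subSS.
have := leq_ord (s ord0) => s0n.
rewrite subnKC // eqxx andbT big1 ?addn0; first by case: (_ <= r).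
move=> i; rewrite -val_eqE /= subSS; case: (i <= r) => //.
by case: (_ + i =P n); [lia|rewrite andbF].
Qed.

(** Here the first letter is the smallest; it takes part in no occurrence and can be deleted. *)
Lemma starting_diag r n : starting r n n = h r n.
Proof.
case: n => [|n]; last by rewrite starting_pos ?ltnSn // -h_starting.
by rewrite [RHS]h_small // -(h_small r (leqnn 1)) h_starting big_ord1.
Qed.

(** By [starting_pos], consecutive values of [d] give partial sums that differ by their last
    term. *)
Lemma starting_pascal r d n : d < n ->
  starting r d.+2 n.+1 = starting r d.+1 n.+1 + starting r d.+1 n.
Proof.
move=> dn; rewrite starting_pos; last by lia.
by rewrite big_ord_recr -starting_pos; last by lia.
Qed.

Lemma starting_binomial r d n :
  starting r d.+1 (n + d).+1 = \sum_(i < d.+1) 'C(d, i) * starting r 0 (n + i).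
Proof.
elim: d n => [|d IHd] n.
  by rewrite starting_pos // !big_ord1 !addn0 mul1n.
rewrite starting_pascal; last by lia.
rewrite addnS IHd -addSn IHd.
(* The extreme terms are split off; Pascal's rule merges the inner ones. *)
rewrite [RHS]big_ord_recl big_ord_recr [X in _ = _ + X]big_ord_recr /= !bin0 !binn.
rewrite [X in _ + X]big_ord_recl /= bin0 !addn0 !mul1n.
under [X in _ = _ + (X + _)]eq_bigr => i _ do rewrite binS mulnDl addnS -addSn.
rewrite big_split /=.
under [X in _ + (_ + X) = _]eq_bigr => i _ do rewrite /bump add1n addnS -addSn.
by rewrite addSn addnS; lia.
Qed.

(** * From binomial sums of [starting] to sums of [h] *)

(** Pascal's rule for the binomials is played against [starting_pascal]; the latter fails on the
    diagonal, whose term becomes the [h] correction. A sum is moved across to avoid subtraction. *)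
Lemma sum_bin_starting_step r d N : d <= N ->
  \sum_(d.+1 <= k < N.+2) 'C(N.+1, k) * starting r d.+1 k +
  \sum_(d.+2 <= k < N.+1) 'C(N, k) * starting r d.+2 k =
  'C(N, d) * h r d.+1 +
  \sum_(d.+2 <= k < N.+2) 'C(N.+1, k) * starting r d.+2 k.
Proof.
have pascal m f : m <= N ->
    \sum_(m.+1 <= k < N.+2) 'C(N.+1, k) * f k =
    \sum_(m.+1 <= k < N.+1) 'C(N, k) * f k +
    \sum_(m <= k < N.+1) 'C(N, k) * f k.+1.
  move=> mN; rewrite big_add1 /=.
  under eq_bigr => k _ do rewrite binS mulnDl.
  rewrite big_split /= big_nat_recr //= bin_small // mul0n addn0.
  by rewrite [in RHS]big_add1.
move=> dN; rewrite pascal // [X in _ + X + _]big_ltn // starting_diag.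
have [->|dN'] := eqVneq d N; first by rewrite !big_geq //; lia.
rewrite pascal; last by lia.
under [X in _ = _ + (_ + X)]eq_big_nat => k /andP[dk _] do
  rewrite starting_pascal // mulnDr.
by rewrite big_split /=; lia.
Qed.

(** Pascal's rule at each fixed [m], except at the ends: [m = d.+1] gives the correction, and at
    [m = N.+1] both binomials are 1. *)
Lemma sum_bin_h_step r d N : d <= N ->
  \sum_(d.+1 <= m < N.+2) 'C(N.+1 - m + d, d) * h r m +
  \sum_(d.+2 <= m < N.+1) 'C(N - m + d.+1, d.+1) * h r m =
  'C(N, d) * h r d.+1 +
  \sum_(d.+2 <= m < N.+2) 'C(N.+1 - m + d.+1, d.+1) * h r m.
Proof.
move=> dN; rewrite big_ltn // subSS subnK // -addnA; congr (_ + _).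
have [->|dN'] := eqVneq d N; first by rewrite !big_geq //; lia.
have d2N : d.+2 <= N.+1 by lia.
rewrite [X in X + _]big_nat_recr // [RHS]big_nat_recr //= subnn !binn addnAC.
congr (_ + _); rewrite -big_split; apply: eq_big_nat => m /andP[_ mN] /=.
by rewrite -mulnDl subSn // addSn !addnS [in RHS]binS addnC.
Qed.

(* Both sides satisfy the recurrence of the two previous lemmas, which
   determines them from the pairs [(d, N)] with [N <= d]. *)
Lemma sum_bin_starting r d N :
  \sum_(d.+1 <= k < N.+1) 'C(N, k) * starting r d.+1 k =
  \sum_(d.+1 <= m < N.+1) 'C(N - m + d, d) * h r m.
Proof.
have [n] := ubnP (N - d); elim: n d N => // n IHn d [|N] Nd.
  by rewrite !big_geq.
have [Nd'|dN] := leqP N.+1 d; first by rewrite !big_geq.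
apply/eqP; rewrite -(eqn_add2r (\sum_(d.+2 <= k < N.+1)
  'C(N, k) * starting r d.+2 k)) sum_bin_starting_step //.
by rewrite !IHn ?sum_bin_h_step //; lia.
Qed.

(** * The recurrence for [h] *)

Lemma sum_ord_swap (F : nat -> nat) m n :
  \sum_(i < m | i < n) F i = \sum_(i < n | i < m) F i.
Proof.
rewrite (big_ord_widen_cond (m + n) (fun i => i < n)) ?leq_addr //.
rewrite [RHS](big_ord_widen_cond (m + n) (fun i => i < m)) ?leq_addl //.
by apply: eq_bigl => i; rewrite andbC.
Qed.

Lemma starting0_rec r n :
  starting r 0 n.+1 =
  starting r 0 n + \sum_(d < r | d < n) starting (r - d.+1) d.+1 n.
Proof.
rewrite starting0 big_mkcond big_ord_recl /= subn0 -big_mkcond /=.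
by rewrite -(sum_ord_swap (fun d => starting (r - d.+1) d.+1 n)).
Qed.

Lemma h_rec r n :
  h r n.+2 = 2 * h r n.+1 +
    \sum_(d < r) \sum_(d.+1 <= m < n.+1) 'C(n - m + d, d) * h (r - d.+1) m.
Proof.
(* One Pascal step off the diagonal yields the first copy of [h r n.+1]. *)
rewrite -starting_diag starting_pascal // starting_diag.
rewrite (starting_binomial r n 1) mul2n -addnn [RHS]addnAC; congr (_ + _).
rewrite -[in RHS]starting_diag (starting_binomial r n 0).
(* The terms [starting r 0 i] reassemble into the second copy. *)
under eq_bigr => i _ do rewrite add1n starting0_rec mulnDr.
rewrite big_split /=; congr (_ + _).
under [RHS]eq_bigr do rewrite -sum_bin_starting big_geq_mkord big_mkcond.
rewrite [RHS]exchange_big /=; apply: eq_bigr => i _.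
by rewrite -big_mkcond big_distrr.
Qed.

Import GRing.Theory.
Local Open Scope ring_scope.

(** * Coefficients of the power series *)

Section SeriesCoefficients.
Variable R : comNzRingType.
Implicit Types f : fps R.

Lemma fpsE_sum I (s : seq I) (P : pred I) (F : I -> fps R) n :
  (\sum_(i <- s | P i) F i) n = \sum_(i <- s | P i) F i n.
Proof. exact: (big_morph (fun f : fps R => f n) (fun f g => fpsED f g n)). Qed.

Lemma fpsE_1BcX_mul c f n :
  ((1 - c%:R * fpsX) * f) n = f n - c%:R * (if n is m.+1 then f m else 0).
Proof.
rewrite mulrBl mul1r fpsED fpsEN -mulrA [in LHS]mulr_natl fpsEMn fpsEXM.
by rewrite mulr_natl.
Qed.

Lemma fps_1BX_unit : (1 - fpsX : fps R) \is a GRing.unit.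
Proof. by rewrite -[fpsX]mul1r (fps_1BcX_unit R 1). Qed.

Lemma fps_1BX_expV d :
  (1 - fpsX) ^- d.+1 = Fps (fun n => 'C(n + d, d)%:R) :> fps R.
Proof.
(* Multiplying by [1 - fpsX] takes backward differences, which lower [d'] by Pascal's rule. *)
have E d' : (1 - fpsX) * Fps (fun n => 'C(n + d', d')%:R) =
    if d' is c.+1 then Fps (fun n => 'C(n + c, c)%:R) else 1 :> fps R.
  apply/fpsP => n; rewrite -[fpsX]mul1r (fpsE_1BcX_mul 1) mul1r /=.
  case: d' => [|c]; first by case: n => [|n]; rewrite ?bin0 ?subr0 ?subrr.
  case: n => [|n] /=; first by rewrite !add0n !binn subr0.
  by rewrite -!addSnnS (binS (n.+1 + c)) natrD addrAC subrr add0r.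
apply: (mulrI (unitrX d.+1 fps_1BX_unit)).
rewrite divrr ?unitrX ?fps_1BX_unit //; elim: d => [|d IHd].
  by rewrite E.
by rewrite exprSr -mulrA E.
Qed.

Lemma fpsE_div_1BX f d n :
  (f / (1 - fpsX) ^+ d.+1) n = \sum_(i < n.+1) f i *+ 'C(n - i + d, d).
Proof.
rewrite fps_1BX_expV fpsEM; apply: eq_bigr => i _ /=.
by rewrite mulr_natr.
Qed.

Lemma fpsE_X2_mul f n : (fpsX ^+ 2 * f) n = if n is m.+2 then f m else 0.
Proof. by rewrite expr2 -mulrA fpsEXM; case: n => // n; rewrite fpsEXM. Qed.

Lemma fpsE_natr c f n : (c%:R * f) n = f n *+ c.
Proof. by rewrite mulr_natl fpsEMn. Qed.

End SeriesCoefficients.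

Lemma H_sub_trunc r m n :
  (H r - \sum_(0 <= j < m) (h r j)%:R * fpsX ^+ j) n =
  if (n < m)%N then 0 else (h r n)%:R.
Proof.
rewrite fpsED fpsEN fpsE_sum big_mkord.
under eq_bigr do rewrite fpsE_natr fpsEXn.
case: ltnP => [nm|mn].
  rewrite (bigD1 (Ordinal nm)) //= eqxx big1 ?addr0 ?subrr // => j.
  by rewrite -val_eqE eq_sym => /negPf /= ->; rewrite mul0rn.
rewrite big1 ?subr0 // => j _.
by rewrite gtn_eqF ?mul0rn // (leq_trans (ltn_ord j)).
Qed.

Lemma fpsE_sum_H_sub_trunc r n :
  (\sum_(1 <= d < r.+1)
     (H (r - d)%N - \sum_(0 <= j < d) (h (r - d)%N j)%:R * fpsX ^+ j)
     / (1 - fpsX) ^+ d) n =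
  (\sum_(d < r) \sum_(d.+1 <= m < n.+1)
     'C(n - m + d, d) * h (r - d.+1) m)%:R.
Proof.
rewrite fpsE_sum big_add1 big_mkord natr_sum; apply: eq_bigr => d _.
rewrite fpsE_div_1BX natr_sum [RHS]big_geq_mkord [RHS]big_mkcond.
apply: eq_bigr => m _; rewrite H_sub_trunc ltnS leqNgt andTb.
by case: ltnP => _; rewrite ?mul0rn // natrM mulr_natl.
Qed.

Theorem theorem4p11 (r : nat) :
  H r = (1 - fpsX) / (1 - 2%:R * fpsX) * (r == 0%N)%:R
        + fpsX ^+ 2 / (1 - 2%:R * fpsX)
          * \sum_(1 <= d < r.+1)
              (H (r - d)%N - \sum_(0 <= j < d) (h (r - d)%N j)%:R * fpsX ^+ j)
              / (1 - fpsX) ^+ d.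
Proof.
have unit2 := fps_1BcX_unit rat 2.
have cancel (f g : fps rat) :
    (1 - 2%:R * fpsX) * (f / (1 - 2%:R * fpsX) * g) = f * g.
  by rewrite mulrA (mulrC _ (f / _)) divrK.
apply: (mulrI unit2); rewrite mulrDr !cancel.
apply/fpsP => n; rewrite fpsE_1BcX_mul fpsED [_ * (r == _)%:R]mulrC fpsE_natr.
rewrite fpsED fpsEN fpsE1 fpsE_X2_mul.
(* With the denominator cleared, coefficients 0 and 1 are the initial values of [h], giving
   [1 - fpsX]; all others are [h_rec]. *)
case: n => [|[|n]]; rewrite ?fpsE_sum_H_sub_trunc /=.
- by rewrite h_small // mulr0 !subr0 addr0.
- by rewrite !h_small // sub0r addr0; case: (r == 0).
by rewrite h_rec natrD natrM addrAC !subrr mul0rn.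
Qed.
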